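(* Let $C\ge 2$ and $d\ge C-1$ be integers, let $\lambda_{W},\lambda_{H}>0$, and let $D_\lambda$ be a probability distribution on $[0,1]$. Let $y_1,\dots,y_C$ denote the one-hot (standard basis) vectors of $\mathbb{R}^C$. Consider the optimization problem $$\min_{W,\,h_{ii'}^{\lambda}}\ \mathbb{E}_{\lambda\sim D_\lambda}\frac{1}{C^2}\sum_{i=1}^{C}\sum_{i'=1}^{C}\left(\operatorname{CE}\!\left(W h_{ii'}^{\lambda},\ \lambda y_i+(1-\lambda)y_{i'}\right)+\frac{\lambda_{H}}{2}\lVert h_{ii'}^{\lambda}\rVert_2^2\right)+\frac{\lambda_{W}}{2}\lVert W\rVert_F^2 ,$$ over $W\in\mathbb{R}^{C\times d}$ and vectors $h_{ii'}^{\lambda}\in\mathbb{R}^d$ ($1\le i,i'\le C$, $\lambda\in[0,1]$). Assume that at optimality, $W$ is a simplex ETF with multiplier $m\in\mathbb{R}\setminus\{0\}$, and denote the $i$-th row of $W$ (viewed as a vector in $\mathbb{R}^d$) by $w_i$. Then any minimizer of this problem satisfies: 1) (Same-class.) For all $i=1,\dots,C$ and all $\lambda\in[0,1]$, $$h_{ii}^{\lambda}=\frac{(1-C)K}{m^2}\,w_i,$$ where $K<0$ is the unique (negative) solution of the equation $$e^{-CK}-\frac{Cm^2}{(1-C)\lambda_{H}K}+C-1=0 .$$ 2) (Different-class.) For all $i\neq i'$ and all $\lambda\in[0,1]$, $$h_{ii'}^{\lambda}=\frac{1-C}{Cm^2}\Big(\left(K_\lambda-\langle w_i,h_{ii'}^{\lambda}\rangle\right)w_i+\left((C-1)K_\lambda+\langle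 w_i,h_{ii'}^{\lambda}\rangle\right)w_{i'}\Big),$$ where $\langle w_i,h_{ii'}^{\lambda}\rangle$ is of the form (for one of the two choices of the sign $\pm$) $$\log\left(\frac{e^{K_\lambda}}{2}\left(2-C+\frac{Cm^2}{(1-C)K_\lambda\lambda_{H}}\pm\sqrt{\left(C-2-\frac{Cm^2}{(1-C)K_\lambda\lambda_{H}}\right)^2-4e^{-CK_\lambda}}\right)\right),$$ and $K_\lambda<0$ satisfies $$e^{\langle w_i,h_{ii'}^{\lambda}\rangle}=\frac{Cm^2}{(1-C)K_\lambda\lambda_{H}}\,e^{K_\lambda}\left(\frac{(1-C)\lambda_{H}\langle w_i,h_{ii'}^{\lambda}\rangle}{Cm^2}+\lambda\right).$$
   Context: Cross-entropy: for logits $z\in\mathbb{R}^C$ and a probability vector $y\in\mathbb{R}^C$ with entries $y^{(1)},\dots,y^{(C)}$, $\operatorname{CE}(z,y)=-\sum_{k=1}^C y^{(k)}\log\left(\frac{e^{z_k}}{\sum_{l=1}^C e^{z_l}}\right)$. Simplex ETF: a matrix $W\in\mathbb{R}^{C\times d}$ is a simplex equiangular tight frame (ETF) with multiplier $m\in\mathbb{R}\setminus\{0\}$ if $$W=m\sqrt{\tfrac{C}{C-1}}\left(I_C-\tfrac1C\mathbf{1}_C\mathbf{1}_C^\top\right)U^\top$$ for some partial orthogonal matrix $U\in\mathbb{R}^{d\times C}$, i.e. $U^\top U=I_C$, where $I_C$ is the $C\times C$ identity matrix and $\mathbf{1}_C\in\mathbb{R}^C$ is the all-ones vector. $\lVert\cdot\rVert_2$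 is the Euclidean norm, $\lVert\cdot\rVert_F$ the Frobenius norm, and $\langle\cdot,\cdot\rangle$ the standard inner product on $\mathbb{R}^d$. $C$ is the number of classes, $W$ is the classifier, and $h_{ii'}^{\lambda}$ is the last-layer feature associated with the mixed-up target $\lambda y_i+(1-\lambda)y_{i'}$; the features are free optimization variables, one for each triple $(i,i',\lambda)$.
   Formalization: The formulas are claimed for D_λ-almost every λ in [0,1] instead of all λ, since a minimizer's features can be changed at any λ of D_λ-probability zero without changing the objective; features are taken Borel measurable in λ so the expectation is defined. *)

(* Defs.v *)
From HB Require Import structures.
From mathcomp Require Import all_boot all_order all_algebra.
From mathcomp Require Import all_classical all_reals all_analysis.
Import Order.TTheory GRing.Theory Num.Theory.
Import numFieldNormedType.Exports.

Set Implicit Arguments.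
Unset Strict Implicit.
Unset Printing Implicit Defensive.

Local Open Scope classical_set_scope.
Local Open Scope ring_scope.

Definition dotv (R : realType) (n : nat) (u v : 'cV[R]_n) : R :=
  \sum_(k < n) u k 0 * v k 0.

(* The norm that mathcomp-analysis puts on matrices is the sup norm, so the
   Euclidean and Frobenius norms are defined here. *)
Definition norm2 (R : realType) (n : nat) (v : 'cV[R]_n) : R :=
  Num.sqrt (\sum_(k < n) v k 0 ^+ 2).

Definition normF (R : realType) (p n : nat) (A : 'M[R]_(p, n)) : R :=
  Num.sqrt (\sum_(k < p) \sum_(l < n) A k l ^+ 2).

Definition CE (R : realType) (C : nat) (z y : 'cV[R]_C) : R :=
  - \sum_(k < C) y k 0 * ln (expR (z k 0) / \sum_(l < C) expR (z l 0)).

Definition onehot (R : realType) (C : nat) (i : 'I_C) : 'cV[R]_C :=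
  delta_mx i 0.

Definition mixed_target (R : realType) (C : nat) (i i' : 'I_C) (l : R) :
    'cV[R]_C :=
  l *: onehot R i + (1 - l) *: onehot R i'.

Definition classifier_row (R : realType) (C d : nat) (W : 'M[R]_(C, d))
    (i : 'I_C) : 'cV[R]_d :=
  (row i W)^T.

Definition is_simplex_ETF (R : realType) (C d : nat) (m : R)
    (W : 'M[R]_(C, d)) : Prop :=
  m != 0 /\
  exists U : 'M[R]_(d, C),
    U^T *m U = 1%:M /\
    W = (m * Num.sqrt (C%:R / (C%:R - 1))) *:
        ((1%:M - C%:R^-1 *: ((const_mx 1 : 'cV[R]_C) *m
                             (const_mx 1 : 'cV[R]_C)^T)) *m U^T).

(* [h i i' l] is the feature of the mixed-up target l y_i + (1 - l) y_i'. Only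
   its values for l in [0, 1] matter. *)
Definition features (R : realType) (C d : nat) : Type :=
  'I_C -> 'I_C -> R -> 'cV[R]_d.

(* Measurability in l makes the expectation of the loss meaningful. *)
Definition measurable_features (R : realType) (C d : nat)
    (h : features R C d) : Prop :=
  forall (i i' : 'I_C) (j : 'I_d),
    measurable_fun (`[0, 1]%classic : set (measurableTypeR R))
      (fun l : measurableTypeR R => h i i' l j 0).

Definition mixup_loss (R : realType) (C d : nat) (lamH : R)
    (W : 'M[R]_(C, d)) (h : features R C d) (l : R) : R :=
  (C%:R ^+ 2)^-1 *
  \sum_(i < C) \sum_(i' < C)
    (CE (W *m h i i' l) (mixed_target i i' l)
     + lamH / 2 * norm2 (h i i' l) ^+ 2).

(* The mixup loss is nonnegative on [0, 1], so its expectation is defined in the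
   extended reals, with value +oo when it is not integrable. *)
Definition mixup_objective (R : realType) (C d : nat)
    (D : probability (measurableTypeR R) R) (lamW lamH : R)
    (W : 'M[R]_(C, d)) (h : features R C d) : \bar R :=
  (\int[D]_(l in `[0%R, 1%R]) (mixup_loss lamH W h l)%:E
   + (lamW / 2 * normF W ^+ 2)%:E)%E.

Definition is_minimizer (R : realType) (C d : nat)
    (D : probability (measurableTypeR R) R) (lamW lamH : R)
    (W : 'M[R]_(C, d)) (h : features R C d) : Prop :=
  measurable_features h /\
  forall (W' : 'M[R]_(C, d)) (h' : features R C d),
    measurable_features h' ->
    (mixup_objective D lamW lamH W h <= mixup_objective D lamW lamH W' h')%E.

(* Main.v *)
(* A gradient step from the features h, with a step size that depends measurably
   on the current gradients, lowers the mixup loss at every l by at least half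
   the step times the squared gradient; comparing a minimizer with its own
   gradient step shows that the feature gradients vanish for almost every l, with
   no measurable selection of pointwise minimizers.  A stationary feature v with
   target y satisfies lamH v = W^T (y - softmax (W v)), and since W W^T acts as a
   scalar s on vectors of sum 0 when W is a simplex ETF, the logits z = W v solve
   z_k = (s / lamH) (y_k - e^(z_k) / S), with S the sum of the e^(z_k).  Hence all
   logits off the target classes equal the unique root K of
   K = - (s / lamH) e^K / S; this and the vanishing of the sum of the logits give
   the formulas. *)
Require Import Defs.
From mathcomp Require Import all_boot all_order all_algebra.
From mathcomp Require Import all_classical all_reals all_analysis.
From mathcomp Require Import measurable_realfun ring lra.
Import Order.TTheory GRing.Theory Num.Theory.
Import numFieldNormedType.Exports.

Local Open Scope classical_set_scope.
Local Open Scope ring_scope.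

Set Implicit Arguments.
Unset Strict Implicit.

(** * Inner products, softmax and cross-entropy *)

Lemma dotvE (R : realType) (n : nat) (u v : 'cV[R]_n) :
  dotv u v = (u^T *m v) 0 0.
Proof. by rewrite mxE; apply: eq_bigr => k _; rewrite mxE. Qed.

Lemma dotvC (R : realType) (n : nat) (u v : 'cV[R]_n) : dotv u v = dotv v u.
Proof. by apply: eq_bigr => k _; rewrite mulrC. Qed.

Lemma dotvDr (R : realType) (n : nat) (u v w : 'cV[R]_n) :
  dotv u (v + w) = dotv u v + dotv u w.
Proof. by rewrite !dotvE mulmxDr mxE. Qed.

Lemma dotvZr (R : realType) (n : nat) (a : R) (u v : 'cV[R]_n) :
  dotv u (a *: v) = a * dotv u v.
Proof. by rewrite !dotvE -scalemxAr mxE. Qed.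

Lemma dotvNr (R : realType) (n : nat) (u v : 'cV[R]_n) :
  dotv u (- v) = - dotv u v.
Proof. by rewrite -scaleN1r dotvZr mulN1r. Qed.

Lemma dotv_mulmxl (R : realType) (p n : nat) (A : 'M[R]_(p, n))
    (u : 'cV[R]_n) (v : 'cV[R]_p) :
  dotv (A *m u) v = dotv u (A^T *m v).
Proof. by rewrite !dotvE trmx_mul mulmxA. Qed.

Lemma dotv_ge0 (R : realType) (n : nat) (u : 'cV[R]_n) : 0 <= dotv u u.
Proof. by apply: sumr_ge0 => k _; rewrite -expr2 sqr_ge0. Qed.

Lemma dotv_eq0 (R : realType) (n : nat) (u : 'cV[R]_n) :
  dotv u u = 0 -> u = 0.
Proof.
move=> /eqP; rewrite psumr_eq0 => [/allP u0|k _]; last first.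
  by rewrite -expr2 sqr_ge0.
apply/matrixP => k j; rewrite ord1 mxE; apply/eqP.
by have := u0 k (mem_index_enum _); rewrite /= -expr2 sqrf_eq0.
Qed.

Lemma norm2_sqr (R : realType) (n : nat) (u : 'cV[R]_n) :
  norm2 u ^+ 2 = dotv u u.
Proof.
rewrite /norm2 sqr_sqrtr; first by apply: eq_bigr => k _; rewrite expr2.
by apply: sumr_ge0 => k _; rewrite sqr_ge0.
Qed.

Lemma normF_sqr (R : realType) (p n : nat) (A : 'M[R]_(p, n)) :
  normF A ^+ 2 = \sum_(k < p) dotv (row k A)^T (row k A)^T.
Proof.
rewrite /normF sqr_sqrtr; last first.
  by apply: sumr_ge0 => k _; apply: sumr_ge0 => l _; rewrite sqr_ge0.
apply: eq_bigr => k _; apply: eq_bigr => l _.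
by rewrite !mxE expr2.
Qed.

Lemma dotv_cauchy_schwarz (R : realType) (n : nat) (u v : 'cV[R]_n) :
  dotv u v ^+ 2 <= dotv u u * dotv v v.
Proof.
have [u0|u0] := eqVneq (dotv u u) 0.
  rewrite (dotv_eq0 u0) dotvC -(scale0r (0 : 'cV[R]_n)) dotvZr mul0r expr0n /=.
  by rewrite mulr_ge0// dotv_ge0.
have ugt0 : 0 < dotv u u by rewrite lt_neqAle eq_sym u0 dotv_ge0.
(* Expanded, this is [dotv u u] times the difference of the two sides. *)
have := dotv_ge0 (dotv u u *: v - dotv u v *: u).
rewrite dotvDr dotvNr !dotvZr ![dotv (_ - _) _]dotvC !dotvDr !dotvNr !dotvZr.
rewrite (dotvC v u) => h0.
rewrite -subr_ge0 -(pmulr_rge0 _ ugt0); apply: le_trans h0 _.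
by rewrite le_eqVlt; apply/orP; left; apply/eqP; ring.
Qed.

Lemma mulmx_entry_sqr_le (R : realType) (p n : nat) (A : 'M[R]_(p, n))
    (u : 'cV[R]_n) (k : 'I_p) :
  (A *m u) k 0 ^+ 2 <= normF A ^+ 2 * dotv u u.
Proof.
have -> : (A *m u) k 0 = dotv (row k A)^T u.
  by rewrite mxE; apply: eq_bigr => j _; rewrite !mxE.
apply: le_trans (dotv_cauchy_schwarz _ _) _.
rewrite ler_wpM2r ?dotv_ge0// normF_sqr (bigD1 k)//= lerDl.
by apply: sumr_ge0 => l _; exact: dotv_ge0.
Qed.

Definition sumexp (R : realType) (n : nat) (z : 'cV[R]_n) : R :=
  \sum_(k < n) expR (z k 0).

Definition softmax (R : realType) (n : nat) (z : 'cV[R]_n) : 'cV[R]_n :=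
  \col_k (expR (z k 0) / sumexp z).

Lemma sumexp_gt0 (R : realType) (n : nat) (z : 'cV[R]_n) :
  (0 < n)%N -> 0 < sumexp z.
Proof.
case: n z => [//|n] z _; rewrite /sumexp big_ord_recl.
by rewrite ltr_wpDr ?expR_gt0// sumr_ge0// => k _; exact: expR_ge0.
Qed.

Lemma softmax_ge0 (R : realType) (n : nat) (z : 'cV[R]_n) (k : 'I_n) :
  0 <= softmax z k 0.
Proof.
rewrite mxE divr_ge0 ?expR_ge0// ltW// sumexp_gt0//.
exact: leq_ltn_trans (ltn_ord k).
Qed.

Lemma sum_softmax (R : realType) (n : nat) (z : 'cV[R]_n) :
  (0 < n)%N -> \sum_k softmax z k 0 = 1.
Proof.
move=> n0; under eq_bigr do rewrite mxE.
by rewrite -mulr_suml divff// gt_eqF// sumexp_gt0.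
Qed.

(** The entries of [y] sum to 1, so the logarithm of the partition function leaves the sum over
    classes. *)
Lemma CE_E (R : realType) (n : nat) (z y : 'cV[R]_n) :
  (0 < n)%N -> \sum_k y k 0 = 1 -> CE z y = ln (sumexp z) - dotv y z.
Proof.
move=> n0 y1; rewrite /CE /dotv -[ln _]mul1r -{1}y1 mulr_suml -sumrB -sumrN.
apply: eq_bigr => k _; rewrite ln_div ?posrE ?expR_gt0 ?sumexp_gt0//.
by rewrite expRK mulrBr opprB.
Qed.

(** From [1 - x <= expR (- x)] one gets [expR x <= 1 / (1 - x)], and
    [(1 - x)(1 + x + 2x^2) = 1 + x^2 (1 - 2x)] is at least 1 for [x <= 1/2]. *)
Lemma expR_le_quadratic (R : realType) (x : R) :
  x <= 2^-1 -> expR x <= 1 + x + 2 * x ^+ 2.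
Proof.
move=> x2; have e1 : 1 - x <= expR (- x) by exact: expR_ge1Dx.
have x1 : 0 < 1 - x by lra.
rewrite -[x in expR x]opprK expRN.
apply: le_trans (_ : (1 - x)^-1 <= _).
  by rewrite lef_pV2 ?posrE ?expR_gt0.
rewrite -(ler_pM2l x1) divff ?gt_eqF//.
have := sqr_ge0 x; nra.
Qed.

Lemma ln_le_sub1 (R : realType) (x : R) : 0 < x -> ln x <= x - 1.
Proof.
move=> x0; have := @le_ln1Dx R (x - 1); rewrite addrCA subrr addr0.
by apply; lra.
Qed.

(** The ratio of the partition functions at [z + e] and [z] is the softmax average of the
    [expR (e k 0)]. Bounding [ln] by its tangent at 1 and each exponential by a quadratic leaves the
    linear term and an error of at most [2 * M]. *)
Lemma ln_sumexp_le (R : realType) (n : nat) (z e : 'cV[R]_n) (M : R) :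
  (0 < n)%N -> (forall k, e k 0 <= 2^-1) -> (forall k, e k 0 ^+ 2 <= M) ->
  ln (sumexp (z + e)) <= ln (sumexp z) + dotv (softmax z) e + 2 * M.
Proof.
move=> n0 e2 eM; have S0 := sumexp_gt0 z n0.
have Ep : sumexp (z + e) = sumexp z * \sum_k softmax z k 0 * expR (e k 0).
  rewrite mulr_sumr; apply: eq_bigr => k _.
  by rewrite !mxE expRD mulrA mulrCA divff ?mulr1// gt_eqF.
have P0 : 0 < \sum_k softmax z k 0 * expR (e k 0).
  by rewrite -(pmulr_rgt0 _ S0) -Ep sumexp_gt0.
rewrite Ep lnM ?posrE// -addrA lerD2l.
apply: le_trans (ln_le_sub1 P0) _; rewrite lerBlDl.
have eN k : 2 * e k 0 ^+ 2 <= 2 * M by rewrite ler_pM2l.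
move: (2 * M) eN => N eN.
rewrite -{1}(sum_softmax z n0) addrA -big_split /=.
rewrite -[N]mul1r -(sum_softmax z n0) mulr_suml -big_split /=.
apply: ler_sum => k _; rewrite -[X in X + _ * e _ _]mulr1 -!mulrDr.
rewrite ler_wpM2l ?softmax_ge0//.
apply: le_trans (expR_le_quadratic (e2 k)) _.
by rewrite lerD2l.
Qed.

(** * Gradient step on the loss of one sample *)

(** Cross-entropy in the form of [CE_E], for targets [y] of sum 1, plus the feature penalty. *)
Definition sample_loss (R : realType) (n d : nat) (lamH : R)
    (W : 'M[R]_(n, d)) (y : 'cV[R]_n) (v : 'cV[R]_d) : R :=
  ln (sumexp (W *m v)) - dotv y (W *m v) + lamH / 2 * dotv v v.

Definition sample_grad (R : realType) (n d : nat) (lamH : R)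
    (W : 'M[R]_(n, d)) (y : 'cV[R]_n) (v : 'cV[R]_d) : 'cV[R]_d :=
  lamH *: v - W^T *m (y - softmax (W *m v)).

(* The exponential factor keeps the displacement of the logits bounded, so that
   one step size works at every point. *)
Definition step_size (R : realType) (n d : nat) (lamH : R)
    (W : 'M[R]_(n, d)) (g : 'cV[R]_d) : R :=
  (4 * normF W ^+ 2 + lamH + 2)^-1 * expR (- dotv g g).

Lemma step_size_gt0 (R : realType) (n d : nat) (lamH : R)
    (W : 'M[R]_(n, d)) (g : 'cV[R]_d) : 0 < lamH -> 0 < step_size lamH W g.
Proof.
move=> l0; rewrite mulr_gt0 ?expR_gt0// invr_gt0.
by have := sqr_ge0 (normF W); lra.
Qed.

Definition gradient_step (R : realType) (n d : nat) (lamH : R)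
    (W : 'M[R]_(n, d)) (y : 'cV[R]_n) (v : 'cV[R]_d) : 'cV[R]_d :=
  v - step_size lamH W (sample_grad lamH W y v) *: sample_grad lamH W y v.

Definition loss_decrease (R : realType) (n d : nat) (lamH : R)
    (W : 'M[R]_(n, d)) (g : 'cV[R]_d) : R :=
  step_size lamH W g * dotv g g / 2.

(** Along [- t *: g] the first-order change is [- t * dotv g g]. The second-order terms are at most
    [t ^+ 2 * dotv g g * (lamH / 2 + 2 * normF W ^+ 2)], and the step size keeps them below half of
    the first-order gain. *)
Lemma sample_loss_descent (R : realType) (n d : nat) (lamH : R)
    (W : 'M[R]_(n, d)) (y : 'cV[R]_n) (v : 'cV[R]_d) :
  (0 < n)%N -> 0 < lamH ->
  sample_loss lamH W y (gradient_step lamH W y v)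
    + loss_decrease lamH W (sample_grad lamH W y v)
  <= sample_loss lamH W y v.
Proof.
move=> n0 l0; rewrite /gradient_step /loss_decrease.
set g := sample_grad lamH W y v; set t := step_size lamH W g.
have G0 : 0 <= dotv g g := dotv_ge0 g.
have t0 : 0 < t := step_size_gt0 W g l0.
(* One factor of the squared gradient is unfolded, which turns it into the derivative of the loss
   along [g]. *)
have EG : dotv g g = lamH * dotv g v - dotv g (W^T *m (y - softmax (W *m v))).
  by rewrite {2}/g /sample_grad dotvDr dotvNr dotvZr.
set G := dotv g g in G0 EG *.
set B := normF W ^+ 2; have B0 : 0 <= B := sqr_ge0 _.
(* This equation and [t0] are all that is kept about [t]. *)
have tN : t * (4 * B + lamH + 2) = expR (- G).
  by rewrite /t /step_size mulrAC mulVf ?mul1r// gt_eqF// -/B; lra.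
clearbody t; clearbody g.
have x1 : expR (- G) <= 1 by rewrite -expR0 ler_expR; lra.
(* The exponential factor beats the unbounded gradient: [x * expR (- x) <= 1], whence
   [t * G <= 1/2]. *)
have xG : expR (- G) * G <= 1.
  rewrite expRN mulrC ler_pdivrMr ?expR_gt0// mul1r.
  by apply: le_trans (expR_ge1Dx G); lra.
have tB0 : 0 <= t * B by apply: mulr_ge0 => //; exact: ltW.
have tl0 : 0 < t * lamH by exact: mulr_gt0.
have tB : t * B <= 4^-1 by nra.
have tG : t * G <= 2^-1 by nra.
(* The squared displacements of the logits are at most [t ^+ 2 * (B * G)]; this bound keeps the
   displacements in the range of [expR_le_quadratic]. *)
have M4 : t ^+ 2 * (B * G) <= 2^-1 ^+ 2.
  have : 0 <= t * G by apply: mulr_ge0 => //; exact: ltW.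
  by nra.
have -> : sample_loss lamH W y (v - t *: g) =
    ln (sumexp (W *m v + (- t) *: (W *m g))) - dotv y (W *m v)
    + t * dotv y (W *m g)
    + lamH / 2 * (dotv v v - 2 * t * dotv g v + t ^+ 2 * G).
  rewrite /sample_loss mulmxBr -scalemxAr -2!scaleNr !dotvDr !dotvZr.
  rewrite [dotv (v + _) v]dotvC [dotv (v + _) g]dotvC !dotvDr !dotvZr.
  by rewrite (dotvC v g) -/G; ring.
have e2 k : ((- t) *: (W *m g)) k 0 ^+ 2 <= t ^+ 2 * (B * G).
  rewrite mxE exprMn sqrrN ler_wpM2l ?sqr_ge0//.
  exact: mulmx_entry_sqr_le.
have e1 k : ((- t) *: (W *m g)) k 0 <= 2^-1.
  apply: le_trans (ler_norm _) _.
  rewrite -(ler_pXn2r (n := 2)) ?nnegrE ?normr_ge0 ?invr_ge0//.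
  by rewrite real_normK ?num_real//; apply: le_trans (e2 k) M4.
have := ln_sumexp_le (W *m v) n0 e1 e2.
have EP : dotv g (W^T *m (y - softmax (W *m v))) =
    dotv y (W *m g) - dotv (softmax (W *m v)) (W *m g).
  by rewrite -dotv_mulmxl dotvC dotvC dotvDr dotvNr !(dotvC (W *m g)).
rewrite dotvZr /sample_loss.
move: EG; rewrite EP => EG.
(* By [tN], [t * (lamH / 2 + 2 * B) <= 1/2]. *)
have key : t ^+ 2 * G * (lamH / 2 + 2 * B) <= t * G / 2.
  have : 0 <= t * G by apply: mulr_ge0 => //; exact: ltW.
  by nra.
nra.
Qed.

(** * Almost-everywhere stationarity of minimizers *)

(** The integrals satisfy [int f' + int g <= int f <= int f'] with [int f] finite, so the
    nonnegative [g] has integral 0. *)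
Lemma ae_eq0_of_decrease (d : measure_display) (T : measurableType d)
    (R : realType) (mu : {measure set T -> \bar R}) (A : set T)
    (f f' g : T -> R) :
  measurable A ->
  measurable_fun A f -> measurable_fun A f' -> measurable_fun A g ->
  (forall x, A x -> 0 <= f' x) -> (forall x, A x -> 0 <= g x) ->
  (forall x, A x -> f' x + g x <= f x) ->
  (\int[mu]_(x in A) (f x)%:E < +oo)%E ->
  (\int[mu]_(x in A) (f x)%:E <= \int[mu]_(x in A) (f' x)%:E)%E ->
  {ae mu, forall x, A x -> g x = 0}.
Proof.
move=> mA mf mf' mg f'0 g0 dec fin le_ff'.
have mgE : measurable_fun A (EFin \o g) by exact/measurable_EFinP.
have mfE' : measurable_fun A (EFin \o f') by exact/measurable_EFinP.
have sum_le : (\int[mu]_(x in A) (f' x)%:E + \int[mu]_(x in A) (g x)%:E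
    <= \int[mu]_(x in A) (f x)%:E)%E.
  rewrite -ge0_integralD//.
  apply: ge0_le_integral => //.
  - by move=> x Ax; rewrite -EFinD lee_fin addr_ge0 ?f'0 ?g0.
  - exact: emeasurable_funD.
  - exact/measurable_EFinP.
have If'0 : (0 <= \int[mu]_(x in A) (f' x)%:E)%E.
  by apply: integral_ge0 => x Ax; rewrite lee_fin f'0.
have Ig0 : (0 <= \int[mu]_(x in A) (g x)%:E)%E.
  by apply: integral_ge0 => x Ax; rewrite lee_fin g0.
have Ig : (\int[mu]_(x in A) (g x)%:E = 0)%E.
  (* Nonnegativity and finiteness rule out every infinite value; only real integrals remain. *)
  move: sum_le fin le_ff' If'0 Ig0.
  move: (\int[mu]_(x in A) (f' x)%:E)%E (\int[mu]_(x in A) (g x)%:E)%E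
    (\int[mu]_(x in A) (f x)%:E)%E => [a| |] [b| |] [c| |] //=.
  rewrite -EFinD !lee_fin => h1 _ h2 _ h3; congr EFin; lra.
have /ae_eq_integral_abs : (\int[mu]_(x in A) `|(g x)%:E| = 0)%E.
  rewrite -[RHS]Ig; apply: eq_integral => x; rewrite inE => Ax.
  by rewrite gee0_abs// lee_fin g0.
move=> /(_ mA mgE); apply: filterS => x h Ax.
by have /= := h Ax => -[].
Qed.

(** * Measurability of vector-valued maps, entry by entry *)

Section measurable_vectors.
Context {d : measure_display} {T : measurableType d} {R : realType} (A : set T).

Definition measurable_vec (n : nat) (u : T -> 'cV[R]_n) : Prop :=
  forall k, measurable_fun A (fun x => u x k 0).

Lemma measurable_vecB (n : nat) (u v : T -> 'cV[R]_n) :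
  measurable_vec u -> measurable_vec v ->
  measurable_vec (fun x => u x - v x).
Proof.
move=> mu mv k.
rewrite (_ : (fun x => _) = (fun x => u x k 0) \- (fun x => v x k 0)).
  exact: measurable_funB.
by apply/funext => x; rewrite !mxE.
Qed.

Lemma measurable_vecZ (n : nat) (a : T -> R) (u : T -> 'cV[R]_n) :
  measurable_fun A a -> measurable_vec u ->
  measurable_vec (fun x => a x *: u x).
Proof.
move=> ma mu k; rewrite (_ : (fun x => _) = a \* (fun x => u x k 0)).
  exact: measurable_funM.
by apply/funext => x; rewrite !mxE.
Qed.

Lemma measurable_dotv (n : nat) (u v : T -> 'cV[R]_n) :
  measurable_vec u -> measurable_vec v ->
  measurable_fun A (fun x => dotv (u x) (v x)).
Proof.
move=> mu mv; apply: measurable_sum => k.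
exact: measurable_funM.
Qed.

Lemma measurable_vec_cst (n : nat) (u : 'cV[R]_n) : measurable_vec (fun=> u).
Proof. by move=> k; exact: measurable_cst. Qed.

Lemma measurable_vec_mulmx (p n : nat) (M : 'M[R]_(p, n)) (u : T -> 'cV[R]_n) :
  measurable_vec u -> measurable_vec (fun x => M *m u x).
Proof.
move=> mu k; rewrite (_ : (fun x => _) = fun x => \sum_j M k j * u x j 0).
  apply: measurable_sum => j; apply: measurable_funM => //.
by apply/funext => x; rewrite mxE.
Qed.

Lemma measurable_sumexp (n : nat) (u : T -> 'cV[R]_n) :
  measurable_vec u -> measurable_fun A (fun x => sumexp (u x)).
Proof.
move=> mu; apply: measurable_sum => k.
exact: measurableT_comp (@measurable_expR R) (mu k).
Qed.

Lemma measurable_softmax (n : nat) (u : T -> 'cV[R]_n) :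
  measurable_vec u -> measurable_vec (fun x => softmax (u x)).
Proof.
move=> mu k.
(* The quotient becomes the exponential of a difference, covered by the measurability of [expR] and
   [ln]. *)
rewrite (_ : (fun x => _) = fun x => expR (u x k 0 - ln (sumexp (u x)))).
  apply: measurableT_comp (@measurable_expR R) _.
  apply: measurable_funB => //.
  exact: measurableT_comp (@measurable_ln R) (measurable_sumexp mu).
apply/funext => x; rewrite mxE expRB lnK// posrE sumexp_gt0//.
exact: leq_ltn_trans (ltn_ord k).
Qed.

Lemma measurable_sample_grad (n p : nat) (lamH : R) (W : 'M[R]_(n, p))
    (y : T -> 'cV[R]_n) (v : T -> 'cV[R]_p) :
  measurable_vec y -> measurable_vec v ->
  measurable_vec (fun x => sample_grad lamH W (y x) (v x)).
Proof.
move=> my mv; apply: measurable_vecB; first exact: measurable_vecZ.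
apply: measurable_vec_mulmx; apply: measurable_vecB => //.
exact/measurable_softmax/measurable_vec_mulmx.
Qed.

Lemma measurable_sample_loss (n p : nat) (lamH : R) (W : 'M[R]_(n, p))
    (y : T -> 'cV[R]_n) (v : T -> 'cV[R]_p) :
  measurable_vec y -> measurable_vec v ->
  measurable_fun A (fun x => sample_loss lamH W (y x) (v x)).
Proof.
move=> my mv; have mWv := measurable_vec_mulmx W mv.
apply: measurable_funD; last first.
  by apply: measurable_funM => //; exact: measurable_dotv.
apply: measurable_funB; last exact: measurable_dotv.
exact: measurableT_comp (@measurable_ln R) (measurable_sumexp mWv).
Qed.

Lemma measurable_step_size (n p : nat) (lamH : R) (W : 'M[R]_(n, p))
    (g : T -> 'cV[R]_p) :
  measurable_vec g -> measurable_fun A (fun x => step_size lamH W (g x)).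
Proof.
move=> mg; apply: measurable_funM => //.
apply: measurableT_comp (@measurable_expR R) _.
by apply: measurableT_comp => //; exact: measurable_dotv.
Qed.

End measurable_vectors.

(** * Mixed targets and the expected mixup loss *)

Lemma mixed_targetE (R : realType) (C : nat) (i i' k : 'I_C) (l : R) :
  mixed_target i i' l k 0 = l * (k == i)%:R + (1 - l) * (k == i')%:R.
Proof. by rewrite !mxE !andbT. Qed.

Lemma sum_mixed_target (R : realType) (C : nat) (i i' : 'I_C) (l : R) :
  \sum_k mixed_target i i' l k 0 = 1.
Proof.
have E (j : 'I_C) : \sum_k ((k == j)%:R : R) = 1.
  by rewrite (bigD1 j)//= eqxx big1 ?addr0// => k /negbTE ->.
under eq_bigr do rewrite mixed_targetE.
by rewrite big_split /= -!mulr_sumr !E !mulr1 addrC subrK.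
Qed.

Lemma CE_ge0 (R : realType) (n : nat) (z y : 'cV[R]_n) :
  (forall k, 0 <= y k 0) -> 0 <= CE z y.
Proof.
move=> y0; rewrite oppr_ge0; apply: sumr_le0 => k _.
apply: mulr_ge0_le0 => //; apply: ln_le0.
rewrite ler_pdivrMr ?mul1r; last first.
  exact: (sumexp_gt0 z (leq_ltn_trans _ (ltn_ord k))).
by rewrite (bigD1 k)//= lerDl sumr_ge0// => j _; exact: expR_ge0.
Qed.

Lemma mixup_loss_ge0 (R : realType) (C d : nat) (lamH : R)
    (W : 'M[R]_(C, d)) (h : features R C d) (l : R) :
  0 <= lamH -> l \in `[0, 1] -> 0 <= mixup_loss lamH W h l.
Proof.
move=> lamH0; rewrite in_itv /= => /andP[l0 l1].
apply: mulr_ge0; first by rewrite invr_ge0 sqr_ge0.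
apply: sumr_ge0 => i _; apply: sumr_ge0 => i' _.
apply: addr_ge0; last by apply: mulr_ge0; rewrite ?divr_ge0 ?sqr_ge0.
apply: CE_ge0 => k; rewrite mixed_targetE.
by apply: addr_ge0; apply: mulr_ge0; rewrite ?subr_ge0 ?ler0n.
Qed.

Lemma mixup_lossE (R : realType) (C d : nat) (lamH : R)
    (W : 'M[R]_(C, d)) (h : features R C d) (l : R) :
  (0 < C)%N ->
  mixup_loss lamH W h l = (C%:R ^+ 2)^-1 *
    \sum_i \sum_i' sample_loss lamH W (mixed_target i i' l) (h i i' l).
Proof.
move=> C0; congr (_ * _); apply: eq_bigr => i _; apply: eq_bigr => i' _.
by rewrite CE_E// ?sum_mixed_target// norm2_sqr.
Qed.

Lemma measurable_mixed_target (R : realType) (C : nat) (A : set R)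
    (i i' : 'I_C) :
  measurable_vec A (fun l : measurableTypeR R => mixed_target i i' l).
Proof.
move=> k; under eq_fun do rewrite mixed_targetE.
apply: measurable_funD; apply: measurable_funM => //.
exact: measurable_funB.
Qed.

Lemma measurable_mixup_loss (R : realType) (C d : nat) (lamH : R)
    (W : 'M[R]_(C, d)) (h : features R C d) :
  (0 < C)%N -> measurable_features h ->
  measurable_fun (`[0, 1]%classic : set (measurableTypeR R))
    (mixup_loss lamH W h).
Proof.
move=> C0 mh; rewrite (_ : mixup_loss lamH W h = fun l => (C%:R ^+ 2)^-1 *
    \sum_i \sum_i' sample_loss lamH W (mixed_target i i' l) (h i i' l)).
  apply: measurable_funM => //.
  apply: measurable_sum => i; apply: measurable_sum => i'.
  apply: measurable_sample_loss; last exact: mh.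
  exact: measurable_mixed_target.
by apply/funext => l; rewrite mixup_lossE.
Qed.

(** The zero classifier with zero features is a competitor of constant loss, so the minimal
    objective is finite. *)
Lemma minimizer_loss_finite (R : realType) (C d : nat)
    (D : probability (measurableTypeR R) R) (lamW lamH : R)
    (W : 'M[R]_(C, d)) (h : features R C d) :
  (0 < C)%N -> D (`[0, 1]%classic : set R) = 1%E ->
  is_minimizer D lamW lamH W h ->
  (\int[D]_(l in `[0%R, 1%R]) (mixup_loss lamH W h l)%:E < +oo)%E.
Proof.
move=> C0 D1 [_ /(_ 0 (fun _ _ _ => 0))].
have m0 : measurable_features (fun _ _ _ => 0 : 'cV[R]_d).
  by move=> C' i i' j; exact: measurable_vec_cst.
move=> /(_ (m0 C)); rewrite /mixup_objective.
under [X in (_ <= X + _)%E]eq_integral.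
  move=> l _; rewrite mixup_lossE//.
  (* Each zero vector is written as [0 *: 0], so that [dotvZr] removes the inner products and only
     the partition term is left. *)
  under eq_bigr do under eq_bigr do
    rewrite /sample_loss mulmx0 -(scale0r (0 : 'cV[R]_d))
      -(scale0r (0 : 'cV[R]_C)) !dotvZr !mul0r mulr0 subr0 addr0.
  over.
rewrite integral_cst//= [D _]D1 mule1.
by case: (integral _ _ _) => //= r _; rewrite ltry.
Qed.

(** The competitor keeps [W] and moves every feature by one gradient step, so the penalty on [W]
    cancels. The total decrease is a sum of nonnegative terms over the class pairs; where it
    vanishes, every gradient does. *)
Lemma minimizer_stationary (R : realType) (C d : nat)
    (D : probability (measurableTypeR R) R) (lamW lamH : R)
    (W : 'M[R]_(C, d)) (h : features R C d) :
  (0 < C)%N -> 0 < lamH -> D (`[0, 1]%classic : set R) = 1%E ->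
  is_minimizer D lamW lamH W h ->
  {ae D, forall l : R, l \in `[0, 1] -> forall i i',
    sample_grad lamH W (mixed_target i i' l) (h i i' l) = 0}.
Proof.
move=> C0 lamH0 D1 hmin; have [mh hopt] := hmin.
have mgrad i i' : measurable_vec (`[0, 1]%classic : set (measurableTypeR R))
    (fun l => sample_grad lamH W (mixed_target i i' l) (h i i' l)).
  apply: measurable_sample_grad; last exact: mh.
  exact: measurable_mixed_target.
pose h' : features R C d := fun i i' l =>
  gradient_step lamH W (mixed_target i i' l) (h i i' l).
have mh' : measurable_features h'.
  move=> i i'; apply: measurable_vecB; first exact: mh.
  by apply: measurable_vecZ => //; exact: measurable_step_size.
pose dec (l : R) := (C%:R ^+ 2)^-1 * \sum_i \sum_i'
  loss_decrease lamH W (sample_grad lamH W (mixed_target i i' l) (h i i' l)).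
have C2 : 0 < (C%:R ^+ 2)^-1 :> R by rewrite invr_gt0 exprn_gt0// ltr0n.
have dec_ge0 (g : 'cV[R]_d) : 0 <= loss_decrease lamH W g.
  rewrite /loss_decrease mulr_ge0// mulr_ge0 ?dotv_ge0//.
  exact/ltW/step_size_gt0.
have : {ae D, forall l, `[0, 1]%classic l -> dec l = 0}.
  apply: (@ae_eq0_of_decrease _ (measurableTypeR R) R D `[0, 1]%classic
    (mixup_loss lamH W h) (mixup_loss lamH W h') dec) => //.
  - exact: measurable_mixup_loss.
  - exact: measurable_mixup_loss.
  - apply: measurable_funM => //.
    apply: measurable_sum => i; apply: measurable_sum => i'.
    do 2 apply: measurable_funM => //; last exact: measurable_dotv.
    exact: measurable_step_size.
  - by move=> l l01; apply: mixup_loss_ge0 => //; exact: ltW.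
  - move=> l _; rewrite mulr_ge0 ?(ltW C2)//.
    by apply: sumr_ge0 => i _; apply: sumr_ge0.
  - move=> l _; rewrite !mixup_lossE// -mulrDr ler_pM2l//.
    rewrite -big_split; apply: ler_sum => i _.
    rewrite -big_split; apply: ler_sum => i' _.
    exact: sample_loss_descent.
  - exact: minimizer_loss_finite hmin.
  - by have := hopt W h' mh'; rewrite /mixup_objective leeD2rE.
apply: (@filterS _ _ (ae_filter_ringOfSetsType D)) => l dec0 l01 i i'.
have /eqP := dec0 l01; rewrite mulf_eq0 gt_eqF//= psumr_eq0; last first.
  by move=> j _; apply: sumr_ge0.
move=> /allP/(_ i (mem_index_enum _))/=; rewrite psumr_eq0//.
move=> /allP/(_ i' (mem_index_enum _))/=.
rewrite /loss_decrease mulf_eq0 invr_eq0 pnatr_eq0 orbF mulf_eq0.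
by rewrite gt_eqF ?step_size_gt0//= => /eqP/dotv_eq0.
Qed.

(** * Stationary features of a simplex ETF *)

(** For [b > 0], [x + b * expR x] increases strictly in [x] and increases in [b], so its solutions
    move up with [u] and down with [b]. *)
Lemma expR_balance_mono (R : realType) (b b' u u' x x' : R) :
  0 < b' -> b' <= b -> u <= u' ->
  x + b * expR x = u -> x' + b' * expR x' = u' -> x <= x'.
Proof.
move=> b0 bb uu ex ex'; rewrite leNgt; apply/negP => xx.
have : expR x' < expR x by rewrite ltr_expR.
have := expR_gt0 x'; nra.
Qed.

Lemma expR_balance_exists (R : realType) (b : R) : 0 < b ->
  exists2 x : R, x < 0 & x + b * expR x = 0.
Proof.
move=> b0; pose f (x : R) := x + b * expR x.
have f0 : 0 < f 0 by rewrite /f expR0 add0r mulr1.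
(* At [- b] the value is [b * (expR (- b) - 1)] and at 0 it is [b], so a root lies in [[- b, 0]] and
   is not 0. *)
have fb : f (- b) <= 0.
  have : expR (- b) <= 1 by rewrite -expR0 ler_expR; lra.
  by rewrite /f; nra.
have cf : {within `[- b, 0], continuous f}.
  apply: continuous_subspaceT => x.
  apply: cvgD; first exact: cvg_id.
  by apply: cvgM; [exact: cvg_cst|exact: continuous_expR].
have [||x xI fx] := @IVT R f (- b) 0 0 _ cf.
- by lra.
- by rewrite ge_min le_max fb (ltW f0) orbT.
exists x => //; rewrite lt_neqAle; move: xI; rewrite in_itv /= => /andP[_ ->].
by rewrite andbT; apply/eqP => x0; move: fx f0; rewrite x0 => ->; rewrite ltxx.
Qed.

Lemma sum_split1 (R : nzRingType) (n : nat) (F : 'I_n -> R) (i : 'I_n) (x : R) :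
  (forall k, k != i -> F k = x) -> \sum_k F k = F i + (n%:R - 1) * x.
Proof.
move=> Fx; rewrite (bigD1 i)//=; congr (_ + _).
rewrite (eq_bigr (fun=> x))// sumr_const cardC1 card_ord -[x *+ _]mulr_natl.
by rewrite -subn1 natrB// (leq_ltn_trans _ (ltn_ord i)).
Qed.

Lemma sum_split2 (R : nzRingType) (n : nat) (F : 'I_n -> R) (i j : 'I_n) (x : R) :
  i != j -> (forall k, k != i -> k != j -> F k = x) ->
  \sum_k F k = F i + F j + (n%:R - 2) * x.
Proof.
move=> ij Fx; rewrite (bigD1 i)//= (bigD1 j)/=; last by rewrite eq_sym.
rewrite addrA; congr (_ + _).
rewrite (eq_bigr (fun=> x)); last by move=> k /andP[]; exact: Fx.
rewrite sumr_const -[x *+ _]mulr_natl; congr (_ * _).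
have n2 : (2 <= n)%N.
  by have := max_card (pred2 i j); rewrite card2 ij card_ord.
rewrite -natrB//; congr (_%:R).
rewrite (eq_card (B := predC (pred2 i j))); last first.
  by move=> k; rewrite !inE negb_or.
have := cardC (pred2 i j); rewrite card2 ij card_ord => E; apply/eqP.
by rewrite -(eqn_add2l 2) subnKC// -[X in _ == X]E.
Qed.

(* The nonzero eigenvalue of [W *m W^T] for a simplex ETF [W]. *)
Definition ETF_scale (R : realType) (C : nat) (m : R) : R :=
  C%:R * m ^+ 2 / (C%:R - 1).

Lemma ETF_scale_gt0 (R : realType) (C : nat) (m : R) :
  (2 <= C)%N -> m != 0 -> 0 < ETF_scale C m.
Proof.
move=> C2 m0; have c1 : 1 < C%:R :> R by rewrite ltr1n.
apply: divr_gt0; last by lra.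
by apply: mulr_gt0; [lra|rewrite exprn_even_gt0].
Qed.

(** Up to a factor [s], [W] is [P *m U^T] with [P] the orthogonal projection onto the vectors of sum
    0. Since [U^T *m U = 1], [W *m W^T] is [s ^+ 2 *: P], and [P] kills the all-ones vector and
    fixes the vectors of sum 0. *)
Lemma ETF_mulmx (R : realType) (C d : nat) (m : R) (W : 'M[R]_(C, d)) :
  (2 <= C)%N -> is_simplex_ETF m W ->
  W^T *m (const_mx 1 : 'cV[R]_C) = 0 /\
  forall u : 'cV[R]_C, \sum_k u k 0 = 0 ->
    W *m (W^T *m u) = ETF_scale C m *: u.
Proof.
move=> C2 [m0 [U [UU ->]]].
have c1 : 1 < C%:R :> R by rewrite ltr1n.
set one := const_mx 1 : 'cV[R]_C; set s := m * _; set P := 1%:M - _.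
have one_dot (u : 'cV[R]_C) : one^T *m u = (\sum_k u k 0)%:M.
  apply/matrixP => i j; rewrite !ord1 !mxE eqxx mulr1n.
  by apply: eq_bigr => k _; rewrite !mxE mul1r.
have s2E : ETF_scale C m = s ^+ 2.
  rewrite /s exprMn sqr_sqrtr /ETF_scale; first by field; rewrite subr_eq0 gt_eqF.
  by apply: divr_ge0; lra.
have PT : P^T = P.
  by rewrite /P raddfB /= trmx1 linearZ /= trmx_mul trmxK.
have P1 : P *m one = 0.
  rewrite /P mulmxBl mul1mx -scalemxAl -mulmxA one_dot mul_mx_scalar.
  under eq_bigr do rewrite mxE.
  have -> : \sum_(k < C) 1 = C%:R :> R by rewrite sumr_const card_ord.
  by rewrite scalerA mulVf ?scale1r ?subrr// gt_eqF//; lra.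
have Pu (u : 'cV[R]_C) : \sum_k u k 0 = 0 -> P *m u = u.
  move=> u0; rewrite /P mulmxBl mul1mx -scalemxAl -mulmxA one_dot u0.
  by rewrite raddf0 mulmx0 scaler0 subr0.
split.
  by rewrite linearZ /= trmx_mul trmxK PT -scalemxAl -mulmxA P1 mulmx0 scaler0.
move=> u u0.
rewrite linearZ /= trmx_mul trmxK PT -!scalemxAl -!scalemxAr scalerA -expr2 -s2E.
congr (_ *: _).
by rewrite -!mulmxA (Pu u u0) (mulmxA U^T) UU mul1mx Pu.
Qed.

Lemma sum_classifier_row (R : realType) (C d : nat) (m : R)
    (W : 'M[R]_(C, d)) :
  (2 <= C)%N -> is_simplex_ETF m W -> \sum_k classifier_row W k = 0.
Proof.
move=> C2 hW; have [W1 _] := ETF_mulmx C2 hW; rewrite -[RHS]W1.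
apply/matrixP => j j'; rewrite ord1 summxE mxE.
by apply: eq_bigr => k _; rewrite !mxE mulr1.
Qed.

(** Applying [W] to [lamH *: v = W^T *m (y - softmax z)] gives an equation in the logits alone,
    because [y - softmax z] has sum 0. Applying [W^T] to that equation recovers [v] from the
    logits. *)
Lemma ETF_stationary (R : realType) (C d : nat) (m lamH : R)
    (W : 'M[R]_(C, d)) (y z : 'cV[R]_C) (v : 'cV[R]_d) :
  (2 <= C)%N -> is_simplex_ETF m W -> 0 < lamH ->
  \sum_k y k 0 = 1 -> sample_grad lamH W y v = 0 -> z = W *m v ->
  let b := ETF_scale C m / lamH in
  [/\ (forall k, z k 0 + b / sumexp z * expR (z k 0) = b * y k 0),
      \sum_k z k 0 = 0
    & ETF_scale C m *: v = \sum_k z k 0 *: classifier_row W k].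
Proof.
move=> C2 hW l0 y1 /subr0_eq + Ez0; rewrite -Ez0 => Ev b.
have [W1 Wu] := ETF_mulmx C2 hW.
have C0 : (0 < C)%N by exact: ltn_trans C2.
have u0 : \sum_k (y - softmax z) k 0 = 0.
  under eq_bigr do rewrite mxE [X in _ + X]mxE.
  by rewrite sumrB y1 sum_softmax// subrr.
have Ez : lamH *: z = ETF_scale C m *: (y - softmax z).
  by rewrite [in LHS]Ez0 scalemxAr Ev Wu.
have Ez' k : z k 0 = b * (y - softmax z) k 0.
  have := congr1 (fun A : 'cV_C => A k 0) Ez.
  rewrite /= [LHS]mxE [RHS]mxE => E.
  by rewrite /b mulrAC -E mulrAC divff ?mul1r// gt_eqF.
split.
- by move=> k; rewrite {1}Ez' !mxE; ring.
- under eq_bigr do rewrite Ez'.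
  by rewrite -mulr_sumr u0 mulr0.
have -> : \sum_k z k 0 *: classifier_row W k = W^T *m z.
  apply/matrixP => j j'; rewrite ord1 summxE mxE.
  by apply: eq_bigr => k _; rewrite !mxE mulrC.
apply: (scalerI (a := lamH)); first by rewrite gt_eqF.
by rewrite scalemxAr Ez -scalemxAr -Ev !scalerA mulrC.
Qed.

Lemma expR_balance_mono_lt (R : realType) (b b' u u' x x' : R) :
  0 < b' -> b' < b -> u <= u' ->
  x + b * expR x = u -> x' + b' * expR x' = u' -> x < x'.
Proof.
move=> b0 bb uu ex ex'; rewrite ltNge; apply/negP => xx.
have : expR x' <= expR x by rewrite ler_expR.
have := expR_gt0 x; nra.
Qed.

(* The logits off the target classes all solve the same strictly monotone scalar
   equation. *)
Lemma ETF_common_logit (R : realType) (C : nat) (b : R) (z y : 'cV[R]_C) (K : R) :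
  0 < b -> (forall k, z k 0 + b * expR (z k 0) = y k 0) ->
  K + b * expR K = 0 -> forall k, y k 0 = 0 -> z k 0 = K.
Proof.
move=> b0 Ez EK k y0; have := Ez k; rewrite y0 => Ezk.
apply/le_anti/andP; split.
  exact: (expR_balance_mono b0 _ _ Ezk EK).
exact: (expR_balance_mono b0 _ _ EK Ezk).
Qed.

(** Multiplication by [K] clears the denominator; for [c = C] the right side is minus
    [ETF_scale C m / lamH]. *)
Lemma same_class_equationE (R : realType) (c m lamH K : R) :
  1 < c -> 0 < lamH -> K != 0 ->
  expR (- c * K) - c * m ^+ 2 / ((1 - c) * lamH * K) + c - 1 = 0 <->
  K * (expR (- c * K) + c - 1) = - (c * m ^+ 2 / (c - 1) / lamH).
Proof.
move=> c1 l0 K0.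
have -> : c * m ^+ 2 / ((1 - c) * lamH * K) =
    - (c * m ^+ 2 / (c - 1) / lamH) / K.
  by field; rewrite K0 (gt_eqF l0) !subr_eq0 (gt_eqF c1) (lt_eqF c1).
move: (- (_ / lamH)) => q; split=> [E|<-].
  rewrite (_ : expR (- c * K) + c - 1 = q / K); last by lra.
  by rewrite mulrCA divff// mulr1.
by rewrite mulrAC divff// mul1r; ring.
Qed.

(** The factor [expR (- c * K) + c - 1] is positive, so every root is negative; on the negative
    reals the left side is strictly increasing. *)
Lemma same_class_equation_unique (R : realType) (c b K K' : R) :
  1 <= c -> 0 < b ->
  K * (expR (- c * K) + c - 1) = - b ->
  K' * (expR (- c * K') + c - 1) = - b -> K = K'.
Proof.
move=> c1 b0.
suff H x x' : x * (expR (- c * x) + c - 1) = - b ->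
    x' * (expR (- c * x') + c - 1) = - b -> x' <= x.
  by move=> E E'; apply/le_anti; rewrite (H _ _ E E') (H _ _ E' E).
move=> E E'; rewrite leNgt; apply/negP => xx.
have ex := expR_gt0 (- c * x); have ex' := expR_gt0 (- c * x').
have : expR (- c * x') < expR (- c * x) by rewrite ltr_expR; nra.
have x'0 : x' < 0 by rewrite ltNge; apply/negP => x'0; nra.
by nra.
Qed.

(** The logits off class [i] share a value [K], and the zero sum fixes the remaining one. The
    partition function is then a function of [K], so the equation for [K] involves neither [v] nor
    [l]. *)
Lemma same_class_features (R : realType) (C d : nat) (m lamH l : R)
    (W : 'M[R]_(C, d)) (i : 'I_C) (v : 'cV[R]_d) :
  (2 <= C)%N -> is_simplex_ETF m W -> 0 < lamH ->
  sample_grad lamH W (mixed_target i i l) v = 0 ->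
  exists K : R, [/\ K < 0,
    K * (expR (- C%:R * K) + C%:R - 1) = - (ETF_scale C m / lamH)
    & v = ((1 - C%:R) * K / m ^+ 2) *: classifier_row W i].
Proof.
move=> C2 hW l0 Egrad; have m0 : m != 0 by case: hW.
have c1 : 1 < C%:R :> R by rewrite ltr1n.
set z := W *m v.
have [Ez sz Ev] := ETF_stationary C2 hW l0 (sum_mixed_target i i l) Egrad
  (erefl z).
have S0 : 0 < sumexp z by rewrite sumexp_gt0// (ltn_trans _ C2).
set b := ETF_scale C m / lamH in Ez *.
have b0 : 0 < b by rewrite divr_gt0 ?ETF_scale_gt0.
have [K K0 EK] := expR_balance_exists (divr_gt0 b0 S0).
have zK k : k != i -> z k 0 = K.
  move=> ki; apply: (ETF_common_logit (divr_gt0 b0 S0)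
    (y := b *: mixed_target i i l)) => //.
    by move=> j; rewrite Ez [RHS]mxE.
  by rewrite mxE mixed_targetE (negbTE ki) !mulr0 addr0 mulr0.
have zi : z i 0 = (1 - C%:R) * K.
  by move: sz; rewrite (sum_split1 zK) => E; lra.
exists K; split => //.
  have ES : sumexp z = expR K * (expR (- C%:R * K) + C%:R - 1).
    rewrite /sumexp (sum_split1 (i := i) (x := expR K)) => [|k ki];
      last by rewrite zK.
    rewrite zi (_ : _ * K = K + - C%:R * K) ?expRD; ring.
  move: EK => /eqP; rewrite addr_eq0 => /eqP EK.
  have eK := expR_gt0 K.
  have : K * sumexp z = - b * expR K.
    by rewrite {1}EK; field; rewrite gt_eqF.
  by rewrite ES mulrCA [RHS]mulrC => /(mulfI (lt0r_neq0 eK)).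
(* The other rows sum to minus row [i], whose coefficient becomes [z i 0 - K]. *)
have Es : ETF_scale C m *: v = ((- C%:R) * K) *: classifier_row W i.
  rewrite Ev (bigD1 i)//= (eq_bigr (fun k => K *: classifier_row W k)).
    rewrite -scaler_sumr; have := sum_classifier_row C2 hW.
    rewrite (bigD1 i)//= => /eqP; rewrite addrC addr_eq0 => /eqP ->.
    by rewrite scalerN -scalerBl zi; congr (_ *: _); ring.
  by move=> k ki; rewrite zK.
apply: (scalerI (a := ETF_scale C m)); first by rewrite gt_eqF// ETF_scale_gt0.
rewrite Es scalerA; congr (_ *: _); rewrite /ETF_scale; field.
by rewrite m0 subr_eq0 gt_eqF.
Qed.

(* The partition function of the stationary logits depends on the two target
   weights only: all logits increase with it, while their sum is fixed. *)
Lemma stationary_sumexp_le (R : realType) (C : nat) (B l : R)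
    (z z' : 'cV[R]_C) (i i' j j' : 'I_C) :
  0 < B -> i != i' -> j != j' ->
  (forall k, z k 0 + B / sumexp z * expR (z k 0)
    = B * mixed_target i i' l k 0) ->
  (forall k, z' k 0 + B / sumexp z' * expR (z' k 0)
    = B * mixed_target j j' l k 0) ->
  \sum_k z k 0 = 0 -> \sum_k z' k 0 = 0 ->
  sumexp z <= sumexp z'.
Proof.
move=> B0 ii jj Ez Ez' sz sz'; rewrite leNgt; apply/negP => SS.
have C2 : (2 <= C)%N.
  by have := max_card (pred2 i i'); rewrite card2 ii card_ord.
have S0 : 0 < sumexp z' by rewrite sumexp_gt0// (ltn_trans _ C2).
have b0 := divr_gt0 B0 (lt_trans S0 SS); have b0' := divr_gt0 B0 S0.
(* A larger partition function means a smaller coefficient in the balance equations, hence larger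
   logits. *)
have bb : B / sumexp z < B / sumexp z'.
  by rewrite ltr_pM2l// ltf_pV2// posrE (lt_trans S0).
have [K _ EK] := expR_balance_exists b0.
have [K' _ EK'] := expR_balance_exists b0'.
have t0 (a a' k : 'I_C) : k != a -> k != a' -> B * mixed_target a a' l k 0 = 0.
  by rewrite mixed_targetE => /negbTE -> /negbTE ->; rewrite !mulr0 addr0 mulr0.
have zK k : k != i -> k != i' -> z k 0 = K.
  move=> ki ki'; apply: (ETF_common_logit b0 (y := B *: mixed_target i i' l)) => //.
    by move=> a; rewrite Ez [RHS]mxE.
  by rewrite mxE t0.
have zK' k : k != j -> k != j' -> z' k 0 = K'.
  move=> kj kj'; apply: (ETF_common_logit b0' (y := B *: mixed_target j j' l)) => //.
    by move=> a; rewrite Ez' [RHS]mxE.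
  by rewrite mxE t0.
(* Target classes are matched by weight: [i] with [j] for [l], [i'] with [j'] for [1 - l]. *)
have h1 : z' j 0 < z i 0.
  apply: (expR_balance_mono_lt b0 bb _ (Ez' j) (Ez i)).
  by rewrite !mixed_targetE !eqxx (negbTE ii) (negbTE jj).
have h2 : z' j' 0 < z i' 0.
  apply: (expR_balance_mono_lt b0 bb _ (Ez' j') (Ez i')).
  by rewrite !mixed_targetE !eqxx eq_sym (negbTE jj) eq_sym (negbTE ii).
have h3 : K' < K by apply: (expR_balance_mono_lt b0 bb _ EK' EK).
(* Both sums vanish although the logits compare strictly; the target classes give strictness even
   when [C - 2 = 0]. *)
move: sz sz'; rewrite (sum_split2 ii zK) (sum_split2 jj zK').
have c2 : 2 <= C%:R :> R by rewrite (ler_nat R 2).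
by nra.
Qed.

(** Completing the square: [t = 2 * x / e + (c - 2 - p)] squares to [r]. This gives [0 <= r], and
    the sign of [t] selects the root. *)
Lemma quadratic_root_form (R : realType) (x p e K c : R) :
  x ^+ 2 + (c - 2 - p) * e * x + e ^+ 2 * K = 0 -> 0 < e ->
  let r := (c - 2 - p) ^+ 2 - 4 * K in
  0 <= r /\
  exists b : bool, x = e / 2 * (2 - c + p + (-1) ^+ b * Num.sqrt r).
Proof.
move=> Ex e0 r; set t := 2 * x / e + (c - 2 - p).
have tr : t ^+ 2 = r.
  rewrite /t /r; apply/eqP; rewrite -subr_eq0; apply/eqP.
  transitivity (4 / e ^+ 2 * (x ^+ 2 + (c - 2 - p) * e * x + e ^+ 2 * K)).
    by field; rewrite gt_eqF.
  by rewrite Ex mulr0.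
have xt : x = e / 2 * (2 - c + p + t) by rewrite /t; field; rewrite gt_eqF.
split; first by rewrite -tr sqr_ge0.
rewrite -tr sqrtr_sqr xt; exists (t < 0); congr (_ * (_ + _)).
by rewrite -realEsign ?num_real.
Qed.

(** [K] is a parameter so that one value can serve all pairs. The logits are [a] at [i], [K] off the
    targets and, by the zero sum, [- a - (c - 2) * K] at [i']. The balance at [K] gives the
    partition function, whose expansion is a quadratic equation in [expR a]; the balance at [i]
    gives the last formula. *)
Lemma different_class_features (R : realType) (C d : nat) (m lamH l : R)
    (W : 'M[R]_(C, d)) (i i' : 'I_C) (v : 'cV[R]_d) (K : R) :
  (2 <= C)%N -> is_simplex_ETF m W -> 0 < lamH -> i != i' ->
  sample_grad lamH W (mixed_target i i' l) v = 0 ->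
  K + ETF_scale C m / lamH / sumexp (W *m v) * expR K = 0 ->
  K < 0 ->
  let w := classifier_row W in
  let c : R := C%:R in
  let a := dotv (w i) v in
  let q := c * m ^+ 2 / ((1 - c) * K * lamH) in
  let r := (c - 2 - q) ^+ 2 - 4 * expR (- c * K) in
  [/\ v = ((1 - c) / (c * m ^+ 2)) *:
        ((K - a) *: w i + ((c - 1) * K + a) *: w i'),
      0 <= r,
      (exists b : bool,
         let x := expR K / 2 * (2 - c + q + (-1) ^+ b * Num.sqrt r) in
         0 < x /\ a = ln x)
    & expR a = q * expR K * ((1 - c) * lamH * a / (c * m ^+ 2) + l)].
Proof.
move=> C2 hW l0 ii Egrad EK K0 w c a q r; have m0 : m != 0 by case: hW.
have c1 : 1 < c by rewrite /c ltr1n.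
have cn0 : c != 0 by rewrite gt_eqF//; lra.
have cn1 : c - 1 != 0 by rewrite gt_eqF//; lra.
set z := W *m v in EK.
have [Ez sz Ev] := ETF_stationary C2 hW l0 (sum_mixed_target i i' l) Egrad
  (erefl z).
have S0 : 0 < sumexp z by rewrite sumexp_gt0// (ltn_trans _ C2).
set B := ETF_scale C m / lamH in Ez EK *.
have B0 : 0 < B by rewrite divr_gt0 ?ETF_scale_gt0.
have b0 := divr_gt0 B0 S0.
have zK k : k != i -> k != i' -> z k 0 = K.
  move=> ki ki'; apply: (ETF_common_logit b0 (y := B *: mixed_target i i' l)) => //.
    by move=> j; rewrite Ez [RHS]mxE.
  by rewrite mxE mixed_targetE (negbTE ki) (negbTE ki') !mulr0 addr0 mulr0.
have za : z i 0 = a.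
  by rewrite /a /z mxE; apply: eq_bigr => k _; rewrite !mxE.
have zi' : z i' 0 = - a - (c - 2) * K.
  by move: sz; rewrite (sum_split2 ii zK) za -/c => E; lra.
have eK := expR_gt0 K.
have Eq : q = - B / K.
  rewrite /q /B /ETF_scale -/c; field.
  by rewrite (lt_eqF K0) (gt_eqF l0) !subr_eq0 (gt_eqF c1) (lt_eqF c1).
have ES : sumexp z = q * expR K.
  have /(congr1 (fun x => x * sumexp z)) := EK.
  rewrite mul0r mulrDl mulrAC divfK ?gt_eqF// => E.
  rewrite Eq mulrAC -[X in X / K](_ : K * sumexp z = _).
    by field; rewrite lt_eqF.
  lra.
have Ea : expR a = sumexp z * (l - a / B).
  have := Ez i; rewrite za mixed_targetE !eqxx (negbTE ii) mulr1 mulr0 addr0 => E.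
  have -> : expR a = sumexp z / B * (B / sumexp z * expR a).
    by field; rewrite !gt_eqF.
  have -> : B / sumexp z * expR a = B * l - a by lra.
  by field; rewrite gt_eqF.
have Esum : sumexp z = expR a + expR (- a - (c - 2) * K) + (c - 2) * expR K.
  rewrite /sumexp (sum_split2 (x := expR K) ii) => [|k ki ki'].
    by rewrite za zi'.
  by rewrite zK.
have Equad : expR a ^+ 2 + (c - 2 - q) * expR K * expR a
    + expR K ^+ 2 * expR (- c * K) = 0.
  (* The constant term is the product of the exponentials of the two target logits. *)
  have -> : expR K ^+ 2 * expR (- c * K) = expR a * expR (- a - (c - 2) * K).
    by rewrite expr2 -!expRD; congr expR; ring.
  move: Esum; rewrite ES; move: (expR (- a - _)) => y Esum.
  transitivity (expR a * (expR a + y + (c - 2) * expR K - q * expR K)); first by ring.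
  by rewrite -Esum subrr mulr0.
have [r0 [b Eb]] := quadratic_root_form Equad eK.
split => //.
- apply: (scalerI (a := ETF_scale C m)); first by rewrite gt_eqF// ETF_scale_gt0.
  (* The rows off the targets sum to [- (w i + w i')], which leaves the coefficients [z i 0 - K] and
     [z i' 0 - K]. *)
  have Es : ETF_scale C m *: v = (a - K) *: w i + (- a - (c - 1) * K) *: w i'.
    rewrite Ev; have := sum_classifier_row C2 hW.
    rewrite (bigD1 i)//= (bigD1 i')/=; last by rewrite eq_sym.
    rewrite [in X in _ -> X](bigD1 i)//= [in X in _ -> X](bigD1 i')/=;
      last by rewrite eq_sym.
    rewrite [in X in _ -> X](eq_bigr (fun k => K *: classifier_row W k)); last first.
      by move=> k /andP[ki ki']; rewrite zK.
    rewrite -scaler_sumr addrA => /eqP; rewrite addrC addr_eq0 => /eqP ->.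
    rewrite za zi' -/w addrA scalerN scalerDr [- (_ *: _ + _)]opprD.
    rewrite addrACA -!scalerBl; congr (_ + _ *: _); ring.
  rewrite Es scalerA scalerDr !scalerA.
  have Ec : ETF_scale C m * ((1 - c) / (c * m ^+ 2)) = -1.
    rewrite /ETF_scale -/c; field.
    by rewrite m0 cn0 cn1.
  by rewrite Ec; congr (_ *: _ + _ *: _); ring.
- exists b; rewrite -/r in Eb *; rewrite -Eb; split; first exact: expR_gt0.
  by rewrite expRK.
rewrite Ea ES; congr (_ * _); rewrite /B /ETF_scale -/c; field.
by rewrite (gt_eqF l0) m0 cn0 cn1.
Qed.

(** Otherwise [[0, 1]] would be negligible, against its mass 1. *)
Lemma ae_unit_interval_exists (R : realType)
    (D : probability (measurableTypeR R) R) (P : R -> Prop) :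
  D (`[0, 1]%classic : set R) = 1%E ->
  {ae D, forall l : R, l \in `[0, 1] -> P l} ->
  exists2 l : R, l \in `[0, 1] & P l.
Proof.
move=> D1 aeP; apply: contrapT => noP.
have : D.-negligible (`[0, 1]%classic : set (measurableTypeR R)).
  apply: negligibleS aeP => l l01 /= Pl.
  by apply: noP; exists l => //; exact: Pl.
move=> /measure_negligible -/(_ (measurable_itv _)).
by rewrite [X in X = _ -> _]D1 => /eqP; rewrite onee_eq0.
Qed.

(** * Assembly over mixing weights and class pairs *)

Unset Implicit Arguments.

(** The objective sees the features only up to a [D]-null set of [l], so the formulas are asserted
    for almost every [l]. [Kl] is chosen before the pair of classes, the sign after it. *)
Theorem theorem3p1 (R : realType) (C d : nat) (lamW lamH : R)
    (D : probability (measurableTypeR R) R) (m : R)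
    (W : 'M[R]_(C, d)) (h : features R C d)
    (hC : (2 <= C)%N) (hd : (C - 1 <= d)%N)
    (hlamW : 0 < lamW) (hlamH : 0 < lamH)
    (hD : D (`[0, 1]%classic : set R) = 1%E)
    (hmin : is_minimizer D lamW lamH W h)
    (hW : is_simplex_ETF m W) :
  let w := classifier_row W in
  let c : R := C%:R in
  (exists K : R,
    [/\ K < 0,
        expR (- c * K) - c * m ^+ 2 / ((1 - c) * lamH * K) + c - 1 = 0,
        (forall K' : R, K' != 0 ->
           expR (- c * K') - c * m ^+ 2 / ((1 - c) * lamH * K') + c - 1 = 0 ->
           K' = K)
      & {ae D, forall l : R, l \in `[0, 1] ->
           forall i : 'I_C, h i i l = ((1 - c) * K / m ^+ 2) *: w i}])
  /\
  {ae D, forall l : R, l \in `[0, 1] ->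
    exists Kl : R, Kl < 0 /\
      forall i i' : 'I_C, i != i' ->
        let a := dotv (w i) (h i i' l) in
        let q := c * m ^+ 2 / ((1 - c) * Kl * lamH) in
        let r := (c - 2 - q) ^+ 2 - 4 * expR (- c * Kl) in
        [/\ h i i' l = ((1 - c) / (c * m ^+ 2)) *:
              ((Kl - a) *: w i + ((c - 1) * Kl + a) *: w i'),
            0 <= r,
            (exists b : bool,
               let x := expR Kl / 2 * (2 - c + q + (-1) ^+ b * Num.sqrt r) in
               0 < x /\ a = ln x)
          & expR a = q * expR Kl * ((1 - c) * lamH * a / (c * m ^+ 2) + l)]}.
Proof.
move=> w c.
have C0 : (0 < C)%N by exact: ltn_trans hC.
have c1 : 1 < c by rewrite /c ltr1n.
have m0 : m != 0 by case: hW.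
have b0 : 0 < ETF_scale C m / lamH by rewrite divr_gt0 ?ETF_scale_gt0.
have stat := minimizer_stationary C0 hlamH hD hmin.
split.
  (* [K] is read off at one stationary [l] and class 0; uniqueness of the root carries it to the
     other weights and classes. *)
  have [l0 _ stat0] := ae_unit_interval_exists hD stat.
  have [K [K0 EK _]] := same_class_features hC hW hlamH
    (stat0 (Ordinal C0) (Ordinal C0)).
  have uniqK K' : K' * (expR (- c * K') + c - 1) = - (ETF_scale C m / lamH) ->
      K' = K.
    by move=> EK'; apply: same_class_equation_unique EK' EK => //; exact: ltW.
  exists K; split => //.
  - by apply/same_class_equationE => //; rewrite lt_eqF.
  - by move=> K' K'0 /same_class_equationE => /(_ c1 hlamH K'0); exact: uniqK.
  apply: (@filterS _ _ (ae_filter_ringOfSetsType D)) stat => l statl l01 i.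
  have [K' [_ EK' ->]] := same_class_features hC hW hlamH (statl l01 i i).
  by rewrite (uniqK K' EK').
apply: (@filterS _ _ (ae_filter_ringOfSetsType D)) stat => l statl l01.
have {}statl := statl l01.
pose i0 := Ordinal C0; pose i1 := Ordinal hC.
have i01 : i0 != i1 by [].
have balance i i' := ETF_stationary hC hW hlamH (sum_mixed_target i i' l)
  (statl i i') (erefl _).
(* The pair of classes 0 and 1 is a reference: all pairs of distinct classes share its partition
   function, hence the same root [K]. *)
pose S := sumexp (W *m h i0 i1 l).
have ES i i' : i != i' -> sumexp (W *m h i i' l) = S.
  move=> ii; have [E s _] := balance i i'; have [E0 s0 _] := balance i0 i1.
  apply/le_anti/andP; split.
    exact: (stationary_sumexp_le b0 ii i01 E E0 s s0).
  exact: (stationary_sumexp_le b0 i01 ii E0 E s0 s).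
have S0 : 0 < S := sumexp_gt0 _ C0.
have [K K0 EK] := expR_balance_exists (divr_gt0 b0 S0).
exists K; split => // i i' ii.
apply: (different_class_features hC hW hlamH ii (statl i i')) => //.
by rewrite ES.
Qed.
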